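(* (1) If $i,j\geq0$, then $\langle\overline{\mathfrak L}^i,\overline{\mathfrak L}^j\rangle\subset\overline{\mathfrak L}^{i+j}$. (2) $\langle\overline{\mathfrak L}^0,\overline{\mathfrak L}^0\rangle\subset\overline{\mathfrak L}^1$.
   Context: $\tilde{\mathfrak L}$ is the free Lie algebra over $\mathbb C$ on two generators $x,y$, with bracket $[,]$, and $\overline{\mathfrak L}:=[\tilde{\mathfrak L},\tilde{\mathfrak L}]$. For $f\in\tilde{\mathfrak L}$, $D_f$ is the derivation of $(\tilde{\mathfrak L},[,])$ such that $D_f(x)=0$ and $D_f(y)=[y,f]$. For $f,g\in\tilde{\mathfrak L}$, $\langle f,g\rangle:=[f,g]+D_f(g)-D_g(f)$; this is a Lie bracket on $\tilde{\mathfrak L}$ and $\overline{\mathfrak L}$ is a Lie subalgebra for it. The filtration is $\overline{\mathfrak L}^0:=\overline{\mathfrak L}$ and $\overline{\mathfrak L}^{i+1}:=[\overline{\mathfrak L},\overline{\mathfrak L}^i]$ for $i\geq0$ (spans of brackets). *)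

(* Defs.v *)
From HB Require Import structures.
From mathcomp Require Import all_boot all_order all_algebra.
From mathcomp Require Import boolp classical_sets reals.
From mathcomp.real_closed Require Export complex.

Set Implicit Arguments.
Unset Strict Implicit.
Unset Printing Implicit Defensive.

Import GRing.Theory.
Local Open Scope ring_scope.
Local Open Scope classical_set_scope.
Local Open Scope quotient_scope.

HB.mixin Record Lmodule_isLieAlgebra (K : fieldType) L of GRing.Lmodule K L := {
  lie : L -> L -> L;
  lie_linearl : forall b, linear (fun a => lie a b);
  lie_linearr : forall a, linear (lie a);
  liexx : forall a, lie a a = 0;
  lie_jacobi : forall a b c,
    lie a (lie b c) + lie b (lie c a) + lie c (lie a b) = 0
}.

#[short(type="lieAlgType")]
HB.structure Definition LieAlgebra (K : fieldType) :=
  {L of Lmodule_isLieAlgebra K L & GRing.Lmodule K L}.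

Notation "[ 'lie' a , b ]" := (lie a b)
  (at level 0, a, b at level 200, format "[ 'lie'  a ,  b ]") : ring_scope.

Definition lie_morphism (K : fieldType) (L M : lieAlgType K) (f : L -> M) : Prop :=
  linear f /\ forall a b, f [lie a, b] = [lie f a, f b].

Definition lie_derivation (K : fieldType) (L : lieAlgType K) (D : L -> L) : Prop :=
  linear D /\ forall a b, D [lie a, b] = [lie D a, b] + [lie a, D b].

Definition lspan (K : fieldType) (V : lmodType K) (S : set V) : set V :=
  [set v | exists n (c : 'I_n -> K) (s : 'I_n -> V),
     (forall i, S (s i)) /\ v = \sum_i c i *: s i].

(* [br] is a parameter because two different brackets are used on the free Lie
   algebra. *)
Definition bracket_span (K : fieldType) (V : lmodType K) (br : V -> V -> V)
    (A B : set V) : set V :=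
  lspan [set br a b | a in A & b in B].

(* The free Lie algebra on X is the type of formal Lie expressions modulo the
   congruence generated by the axioms of a Lie algebra; its universal property
   is freeLie_lift_morphism, freeLie_liftE and freeLie_morphism_ext below. *)
Section FreeLie.
Variables (K : fieldType) (X : Type).

Inductive lterm : Type :=
| LGen of X
| LZero
| LAdd of lterm & lterm
| LScale of K & lterm
| LBr of lterm & lterm.

HB.instance Definition _ := gen_eqMixin lterm.
HB.instance Definition _ := gen_choiceMixin lterm.

Inductive lequiv : lterm -> lterm -> Prop :=
| LE_refl a : lequiv a a
| LE_sym a b : lequiv a b -> lequiv b a
| LE_trans a b c : lequiv a b -> lequiv b c -> lequiv a c
| LE_add a a' b b' : lequiv a a' -> lequiv b b' -> lequiv (LAdd a b) (LAdd a' b')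
| LE_scale k a a' : lequiv a a' -> lequiv (LScale k a) (LScale k a')
| LE_br a a' b b' : lequiv a a' -> lequiv b b' -> lequiv (LBr a b) (LBr a' b')
| LE_addA a b c : lequiv (LAdd a (LAdd b c)) (LAdd (LAdd a b) c)
| LE_addC a b : lequiv (LAdd a b) (LAdd b a)
| LE_add0 a : lequiv (LAdd LZero a) a
| LE_addN a : lequiv (LAdd (LScale (-1) a) a) LZero
| LE_scaleA k l a : lequiv (LScale k (LScale l a)) (LScale (k * l) a)
| LE_scale1 a : lequiv (LScale 1 a) a
| LE_scaleDr k a b :
    lequiv (LScale k (LAdd a b)) (LAdd (LScale k a) (LScale k b))
| LE_scaleDl k l a :
    lequiv (LScale (k + l) a) (LAdd (LScale k a) (LScale l a))
| LE_brDl a b c : lequiv (LBr (LAdd a b) c) (LAdd (LBr a c) (LBr b c))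
| LE_brDr a b c : lequiv (LBr a (LAdd b c)) (LAdd (LBr a b) (LBr a c))
| LE_brZl k a b : lequiv (LBr (LScale k a) b) (LScale k (LBr a b))
| LE_brZr k a b : lequiv (LBr a (LScale k b)) (LScale k (LBr a b))
| LE_brxx a : lequiv (LBr a a) LZero
| LE_jacobi a b c :
    lequiv (LAdd (LAdd (LBr a (LBr b c)) (LBr b (LBr c a))) (LBr c (LBr a b)))
           LZero.

Definition lequivb (a b : lterm) : bool := `[< lequiv a b >].

Lemma lequivb_refl : reflexive lequivb.
Proof. by move=> a; apply/asboolP; exact: LE_refl. Qed.

Lemma lequivb_sym : symmetric lequivb.
Proof.
by move=> a b; apply/idP/idP => /asboolP h; apply/asboolP; exact: LE_sym.
Qed.

Lemma lequivb_trans : transitive lequivb.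
Proof.
move=> b a c /asboolP ab /asboolP bc; apply/asboolP; exact: LE_trans ab bc.
Qed.

Canonical lequivb_equiv :=
  EquivRel lequivb lequivb_refl lequivb_sym lequivb_trans.

Definition freeLie : Type := {eq_quot lequivb}.
HB.instance Definition _ := Choice.on freeLie.

Definition fl_class (t : lterm) : freeLie := \pi_({eq_quot lequivb}) t.
Definition fl_repr (a : freeLie) : lterm := repr (a : {eq_quot lequivb}).

Lemma fl_reprK a : fl_class (fl_repr a) = a.
Proof. exact: reprK. Qed.

Lemma fl_classP a b : fl_class a = fl_class b <-> lequiv a b.
Proof. by split=> [/eqmodP/asboolP //|h]; apply/eqmodP/asboolP. Qed.

Lemma fl_repr_class t : lequiv (fl_repr (fl_class t)) t.
Proof. by apply/fl_classP; rewrite fl_reprK. Qed.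

Lemma fl_ind (P : freeLie -> Prop) : (forall t, P (fl_class t)) -> forall a, P a.
Proof. by move=> h a; rewrite -(fl_reprK a). Qed.

Definition fl_zero := fl_class LZero.
Definition fl_add a b := fl_class (LAdd (fl_repr a) (fl_repr b)).
Definition fl_scale k a := fl_class (LScale k (fl_repr a)).
Definition fl_opp a := fl_scale (-1) a.
Definition fl_br a b := fl_class (LBr (fl_repr a) (fl_repr b)).
Definition fl_gen (x : X) : freeLie := fl_class (LGen x).

Lemma fl_addE s t : fl_add (fl_class s) (fl_class t) = fl_class (LAdd s t).
Proof. by apply/fl_classP; apply: LE_add; exact: fl_repr_class. Qed.

Lemma fl_scaleE k t : fl_scale k (fl_class t) = fl_class (LScale k t).
Proof. by apply/fl_classP; apply: LE_scale; exact: fl_repr_class. Qed.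

Lemma fl_brE s t : fl_br (fl_class s) (fl_class t) = fl_class (LBr s t).
Proof. by apply/fl_classP; apply: LE_br; exact: fl_repr_class. Qed.

Fact fl_addA : associative fl_add.
Proof.
elim/fl_ind=> a; elim/fl_ind=> b; elim/fl_ind=> c; rewrite !fl_addE.
by apply/fl_classP; exact: LE_addA.
Qed.

Fact fl_addC : commutative fl_add.
Proof.
elim/fl_ind=> a; elim/fl_ind=> b; rewrite !fl_addE.
by apply/fl_classP; exact: LE_addC.
Qed.

Fact fl_add0 : left_id fl_zero fl_add.
Proof. by elim/fl_ind=> a; rewrite fl_addE; apply/fl_classP; exact: LE_add0. Qed.

Fact fl_addN : left_inverse fl_zero fl_opp fl_add.
Proof.
elim/fl_ind=> a; rewrite /fl_opp fl_scaleE fl_addE.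
by apply/fl_classP; exact: LE_addN.
Qed.

HB.instance Definition _ :=
  GRing.isZmodule.Build freeLie fl_addA fl_addC fl_add0 fl_addN.

Fact fl_scaleA k l a : fl_scale k (fl_scale l a) = fl_scale (k * l) a.
Proof.
elim/fl_ind: a => a; rewrite !fl_scaleE; apply/fl_classP; exact: LE_scaleA.
Qed.

Fact fl_scale1 : left_id 1 fl_scale.
Proof.
by elim/fl_ind=> a; rewrite fl_scaleE; apply/fl_classP; exact: LE_scale1.
Qed.

Fact fl_scaleDr : right_distributive fl_scale +%R.
Proof.
move=> k; elim/fl_ind=> a; elim/fl_ind=> b.
rewrite -[_ + _]/(fl_add _ _) -[RHS]/(fl_add _ _).
rewrite !(fl_addE, fl_scaleE); apply/fl_classP; exact: LE_scaleDr.
Qed.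

Fact fl_scaleDl a : {morph fl_scale^~ a : k l / k + l}.
Proof.
move=> k l /=; elim/fl_ind: a => a; rewrite -[RHS]/(fl_add _ _).
rewrite !(fl_addE, fl_scaleE); apply/fl_classP; exact: LE_scaleDl.
Qed.

HB.instance Definition _ := GRing.Zmodule_isLmodule.Build K freeLie
  fl_scaleA fl_scale1 fl_scaleDr fl_scaleDl.

Lemma fl_classD s t : fl_class (LAdd s t) = fl_class s + fl_class t.
Proof. by rewrite -fl_addE. Qed.

Lemma fl_classZ k t : fl_class (LScale k t) = k *: fl_class t.
Proof. by rewrite -fl_scaleE. Qed.

Lemma fl_class0 : fl_class LZero = 0.
Proof. by []. Qed.

Fact fl_br_linearl b : linear (fun a => fl_br a b).
Proof.
elim/fl_ind: b => b k; elim/fl_ind=> a; elim/fl_ind=> a'.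
rewrite -fl_classZ -fl_classD !fl_brE -fl_classZ -fl_classD; apply/fl_classP.
apply: LE_trans (LE_brDl _ _ _) _; apply: LE_add (LE_refl _).
exact: LE_brZl.
Qed.

Fact fl_br_linearr a : linear (fl_br a).
Proof.
elim/fl_ind: a => a k; elim/fl_ind=> b; elim/fl_ind=> b'.
rewrite -fl_classZ -fl_classD !fl_brE -fl_classZ -fl_classD; apply/fl_classP.
apply: LE_trans (LE_brDr _ _ _) _; apply: LE_add (LE_refl _).
exact: LE_brZr.
Qed.

Fact fl_brxx a : fl_br a a = 0.
Proof.
by elim/fl_ind: a => a; rewrite fl_brE -fl_class0; apply/fl_classP/LE_brxx.
Qed.

Fact fl_jacobi a b c :
  fl_br a (fl_br b c) + fl_br b (fl_br c a) + fl_br c (fl_br a b) = 0.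
Proof.
elim/fl_ind: a => a; elim/fl_ind: b => b; elim/fl_ind: c => c.
by rewrite !fl_brE -!fl_classD -fl_class0; apply/fl_classP/LE_jacobi.
Qed.

HB.instance Definition _ := Lmodule_isLieAlgebra.Build K freeLie
  fl_br_linearl fl_br_linearr fl_brxx fl_jacobi.

Lemma fl_classB s t : fl_class (LBr s t) = [lie fl_class s, fl_class t].
Proof. by rewrite -fl_brE. Qed.

End FreeLie.

Section LieTheory.
Variables (K : fieldType) (L : lieAlgType K).
Implicit Types a b c : L.

Lemma lieDl a b c : [lie a + b, c] = [lie a, c] + [lie b, c].
Proof. by have /= := lie_linearl c 1 a b; rewrite !scale1r. Qed.

Lemma lieDr a b c : [lie a, b + c] = [lie a, b] + [lie a, c].
Proof. by have := lie_linearr a 1 b c; rewrite !scale1r. Qed.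

Lemma lie0l a : [lie 0, a] = 0.
Proof. by apply: (addrI [lie 0, a]); rewrite -lieDl !addr0. Qed.

Lemma lie0r a : [lie a, 0] = 0.
Proof. by apply: (addrI [lie a, 0]); rewrite -lieDr !addr0. Qed.

Lemma lieZl k a b : [lie k *: a, b] = k *: [lie a, b].
Proof. by have /= := lie_linearl b k a 0; rewrite lie0l !addr0. Qed.

Lemma lieZr k a b : [lie a, k *: b] = k *: [lie a, b].
Proof. by have := lie_linearr a k b 0; rewrite lie0r !addr0. Qed.

Lemma lieC a b : [lie a, b] = - [lie b, a].
Proof.
apply/eqP; rewrite -addr_eq0; apply/eqP.
by have := liexx (a + b); rewrite lieDl !lieDr !liexx add0r addr0.
Qed.

End LieTheory.

Section FreeLieMaps.
Variables (K : fieldType) (X : Type).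
Local Notation F := (freeLie K X).

Section Lift.
Variables (M : lieAlgType K) (v : X -> M).

Fixpoint lterm_lift (t : lterm K X) : M :=
  match t with
  | LGen x => v x
  | LZero => 0
  | LAdd a b => lterm_lift a + lterm_lift b
  | LScale k a => k *: lterm_lift a
  | LBr a b => [lie lterm_lift a, lterm_lift b]
  end.

Lemma lterm_lift_equiv s t : lequiv s t -> lterm_lift s = lterm_lift t.
Proof.
elim=> //=.
- by move=> a b c _ -> _ ->.
- by move=> a a' b b' _ -> _ ->.
- by move=> k a a' _ ->.
- by move=> a a' b b' _ -> _ ->.
- by move=> *; rewrite addrA.
- by move=> *; rewrite addrC.
- by move=> *; rewrite add0r.
- by move=> *; rewrite scaleN1r addNr.
- by move=> *; rewrite scalerA.
- by move=> *; rewrite scale1r.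
- by move=> *; rewrite scalerDr.
- by move=> *; rewrite scalerDl.
- by move=> *; rewrite lieDl.
- by move=> *; rewrite lieDr.
- by move=> *; rewrite lieZl.
- by move=> *; rewrite lieZr.
- by move=> *; rewrite liexx.
- by move=> *; rewrite lie_jacobi.
Qed.

Definition freeLie_lift (a : F) : M := lterm_lift (fl_repr a).

Lemma freeLie_lift_class t : freeLie_lift (fl_class t) = lterm_lift t.
Proof. by apply: lterm_lift_equiv; exact: fl_repr_class. Qed.

Lemma freeLie_lift_morphism : lie_morphism freeLie_lift.
Proof.
split=> [k|]; elim/fl_ind=> a; elim/fl_ind=> b.
  by rewrite -fl_classZ -fl_classD !freeLie_lift_class.
by rewrite -fl_classB !freeLie_lift_class.
Qed.

Lemma freeLie_liftE x : freeLie_lift (fl_gen K x) = v x.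
Proof. exact: freeLie_lift_class. Qed.

End Lift.

Lemma linear_additive0 (V W : lmodType K) (f : V -> W) : linear f ->
  [/\ f 0 = 0, {morph f : a b / a + b} & forall k, {morph f : a / k *: a}].
Proof.
move=> lf.
have fD : {morph f : a b / a + b} by move=> a b; have := lf 1 a b; rewrite !scale1r.
have f0 : f 0 = 0 by apply: (addrI (f 0)); rewrite -fD !addr0.
by split=> // k a; have := lf k a 0; rewrite f0 !addr0.
Qed.

Lemma freeLie_morphism_ext (M : lieAlgType K) (f g : F -> M) :
  lie_morphism f -> lie_morphism g ->
  (forall x, f (fl_gen K x) = g (fl_gen K x)) -> f =1 g.
Proof.
move=> [/linear_additive0[f0 fD fZ] fB] [/linear_additive0[g0 gD gZ] gB] fg.
elim/fl_ind; elim=> [x||a iha b ihb|k a iha|a iha b ihb].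
- exact: fg.
- by rewrite fl_class0 f0 g0.
- by rewrite fl_classD fD gD iha ihb.
- by rewrite fl_classZ fZ gZ iha.
- by rewrite fl_classB fB gB iha ihb.
Qed.

Section Derivation.
Variable v : X -> F.

Fixpoint lterm_der (t : lterm K X) : F :=
  match t with
  | LGen x => v x
  | LZero => 0
  | LAdd a b => lterm_der a + lterm_der b
  | LScale k a => k *: lterm_der a
  | LBr a b => [lie lterm_der a, fl_class b] + [lie fl_class a, lterm_der b]
  end.

Lemma lterm_der_equiv s t : lequiv s t -> lterm_der s = lterm_der t.
Proof.
elim=> /=; rewrite ?(fl_classD, fl_classZ, fl_classB) //=.
- by move=> a b c _ -> _ ->.
- by move=> a a' b b' _ -> _ ->.
- by move=> k a a' _ ->.
- by move=> a a' b b' /fl_classP -> -> /fl_classP -> ->.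
- by move=> *; rewrite addrA.
- by move=> *; rewrite addrC.
- by move=> *; rewrite add0r.
- by move=> *; rewrite scaleN1r addNr.
- by move=> *; rewrite scalerA.
- by move=> *; rewrite scale1r.
- by move=> *; rewrite scalerDr.
- by move=> *; rewrite scalerDl.
- by move=> *; rewrite !fl_classD !lieDl addrACA.
- by move=> *; rewrite !fl_classD !lieDr addrACA.
- by move=> *; rewrite !fl_classZ !lieZl scalerDr.
- by move=> *; rewrite !fl_classZ !lieZr scalerDr.
- by move=> a; rewrite lieC addNr.
- move=> a b c; rewrite !fl_classB !lieDr.
  set A := fl_class a; set B := fl_class b; set C := fl_class c.
  set a' := lterm_der a; set b' := lterm_der b; set c' := lterm_der c.
  have := lie_jacobi A B c'; have := lie_jacobi A b' C; have := lie_jacobi a' B C.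
  move=> ja jb jc; rewrite !addrA.
  rewrite [LHS](ACl ((1*6*8)*(2*4*9)*(3*5*7))%AC) /=.
  by rewrite ja jb jc !addr0.
Qed.

Definition freeLie_der (a : F) : F := lterm_der (fl_repr a).

Lemma freeLie_der_class t : freeLie_der (fl_class t) = lterm_der t.
Proof. by apply: lterm_der_equiv; exact: fl_repr_class. Qed.

Lemma freeLie_derP : lie_derivation freeLie_der.
Proof.
split=> [k|]; elim/fl_ind=> a; elim/fl_ind=> b.
  by rewrite -fl_classZ -fl_classD !freeLie_der_class.
by rewrite -fl_classB !freeLie_der_class.
Qed.

Lemma freeLie_derE x : freeLie_der (fl_gen K x) = v x.
Proof. exact: freeLie_der_class. Qed.

End Derivation.

Lemma freeLie_derivation_ext (D D' : F -> F) :
  lie_derivation D -> lie_derivation D' ->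
  (forall x, D (fl_gen K x) = D' (fl_gen K x)) -> D =1 D'.
Proof.
move=> [/linear_additive0[f0 fD fZ] fB] [/linear_additive0[g0 gD gZ] gB] fg.
elim/fl_ind; elim=> [x||a iha b ihb|k a iha|a iha b ihb].
- exact: fg.
- by rewrite fl_class0 f0 g0.
- by rewrite fl_classD fD gD iha ihb.
- by rewrite fl_classZ fZ gZ iha.
- by rewrite fl_classB fB gB iha ihb.
Qed.

End FreeLieMaps.

Section TwoGenerators.
Variable K : fieldType.

Definition Ltilde : Type := freeLie K bool.
HB.instance Definition _ := LieAlgebra.on Ltilde.

Definition genx : Ltilde := fl_gen K false.
Definition geny : Ltilde := fl_gen K true.

Definition Dder (f : Ltilde) : Ltilde -> Ltilde :=
  freeLie_der (fun b : bool => if b then [lie geny, f] else 0).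

Lemma Dder_derivation f : lie_derivation (Dder f).
Proof. exact: freeLie_derP. Qed.

Lemma Dder_x f : Dder f genx = 0.
Proof. exact: freeLie_derE. Qed.

Lemma Dder_y f : Dder f geny = [lie geny, f].
Proof. exact: freeLie_derE. Qed.

Lemma Dder_unique f (E : Ltilde -> Ltilde) : lie_derivation E ->
  E genx = 0 -> E geny = [lie geny, f] -> E =1 Dder f.
Proof.
move=> dE Ex Ey; apply: freeLie_derivation_ext dE (Dder_derivation f) _.
by case; rewrite -/genx -/geny ?Dder_x ?Dder_y.
Qed.

Definition ihara (f g : Ltilde) : Ltilde := [lie f, g] + Dder f g - Dder g f.

Definition Lbar : set Ltilde := bracket_span (@lie K Ltilde) setT setT.

Fixpoint Lfilt (i : nat) : set Ltilde :=
  if i is j.+1 then bracket_span (@lie K Ltilde) Lbar (Lfilt j) else Lbar.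

End TwoGenerators.

(* Main.v *)
Require Import Defs.
From mathcomp Require Import all_boot all_order all_algebra.
From mathcomp Require Import boolp classical_sets reals.

Set Implicit Arguments.
Unset Strict Implicit.
Unset Printing Implicit Defensive.

Import GRing.Theory.
Local Open Scope ring_scope.
Local Open Scope classical_set_scope.

(** Write [L] for the free Lie algebra on [x, y] over [K] and [L^i] for the filtration,
    which is the lower central series of the ideal [L^0 = [L, L]], shifted so
    that [[L^i, L^j]] lies in [L^(i+j+1)] ([lie_Lfilt]). Every [L^i] is an
    ideal of the whole of [L].

    Part (1). For [f] in [L^i], the derivation [D_f] sends [x] to [0] and [y] to
    [[y, f]], which is in the ideal [L^i]; hence it maps all of [L] to [L^i],
    and the Leibniz rule then gives [D_f (L^j)] in [L^(i+j)]
    ([Dder_Lfilt]). The three terms of [<f, g>] are thus in [L^(i+j)].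

    Part (2). The term [[f, g]] is in [L^1], so the point is that
    [D_f g = D_g f] modulo [L^1]. The quotient [L^0 / L^1] is a module over the
    commutative ring [K[X, Y]], with [X] and [Y] acting by [ad x] and [ad y],
    and it is generated by [[x, y]]. For [f] in [L^0] the map [D_f] induces an
    endomorphism of this module, with [D_f [x, y] = [x, [y, f]] = XY f]. So if
    [f = P [x, y]] and [g = Q [x, y]], then [D_f g = Q XY P [x, y]], which is
    symmetric in [P] and [Q]. In the proof the polynomials do not appear: a
    module map on a cyclic module is determined by its value at the generator
    ([ad_commuting_Lfilt1]), and this is used first in the variable [g], then
    in the variable [f]. *)

(** * Subspaces and ideals of a Lie algebra *)

Definition is_subspace {K : fieldType} {V : lmodType K} (A : set V) : Prop :=
  A 0 /\ forall (k : K) (a b : V), A a -> A b -> A (k *: a + b).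

Section Subspace.
Variables (K : fieldType) (V : lmodType K).
Implicit Types (A S : set V) (a b : V).

Lemma subspaceD A a b : is_subspace A -> A a -> A b -> A (a + b).
Proof. by case=> _ h Aa Ab; rewrite -[a]scale1r; apply: h. Qed.

Lemma subspaceB A a b : is_subspace A -> A a -> A b -> A (a - b).
Proof. by case=> _ h Aa Ab; rewrite addrC -scaleN1r; apply: h. Qed.

Lemma subspace_lspan S : is_subspace (lspan S).
Proof.
split.
  by exists 0, (fun=> 0), (fun=> 0); split; [case | rewrite big_ord0].
move=> k _ _ [n [c [s [Ss ->]]]] [m [d [t [St ->]]]].
exists (n + m)%N,
  (fun i => match split i with inl j => k * c j | inr j => d j end),
  (fun i => match split i with inl j => s j | inr j => t j end).
split; first by move=> i; case: split.
rewrite big_split_ord scaler_sumr; congr (_ + _); apply: eq_bigr => i _.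
  by rewrite (unsplitK (inl i : 'I_n + 'I_m)%type) scalerA.
by rewrite (unsplitK (inr i : 'I_n + 'I_m)%type).
Qed.

Lemma lspan_sub S A : is_subspace A -> S `<=` A -> lspan S `<=` A.
Proof.
move=> sA SA _ [n [c [s [Ss ->]]]].
elim/big_ind: _ => [|a b Aa Ab|i _]; first by case: sA.
  exact: subspaceD.
by case: sA => A0 /(_ (c i) (s i) 0); rewrite addr0; apply=> //; apply: SA.
Qed.

Lemma subspace_bracket_span (br : V -> V -> V) A B :
  is_subspace (bracket_span br A B).
Proof. exact: subspace_lspan. Qed.

Lemma bracket_span_mem (br : V -> V -> V) A B a b :
  A a -> B b -> bracket_span br A B (br a b).
Proof.
move=> Aa Bb; exists 1%N, (fun=> 1), (fun=> br a b).
split; first by move=> _; exists a => //; exists b.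
by rewrite big_ord1 scale1r.
Qed.

Lemma bracket_span_sub (br : V -> V -> V) A B C : is_subspace C ->
  (forall a b, A a -> B b -> C (br a b)) -> bracket_span br A B `<=` C.
Proof.
by move=> sC h; apply: lspan_sub => // _ [a Aa [b Bb <-]]; exact: h.
Qed.

Lemma subspace_preim (W : lmodType K) (E : V -> W) (A : set W) :
  linear E -> is_subspace A -> is_subspace [set a | A (E a)].
Proof.
move=> lE [A0 AD]; have [E0 _ _] := linear_additive0 lE.
by split=> [|k a b Aa Ab] /=; rewrite ?E0 ?lE //; apply: AD.
Qed.

Lemma subspaceI A B : is_subspace A -> is_subspace B -> is_subspace (A `&` B).
Proof.
move=> [A0 AD] [B0 BD]; split=> // k a b [Aa Ba] [Ab Bb].
by split; [apply: AD | apply: BD].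
Qed.

Lemma linearB_fun (W : lmodType K) (E F : V -> W) :
  linear E -> linear F -> linear (fun a => E a - F a).
Proof. by move=> lE lF k a b; rewrite lE lF scalerBr opprD addrACA. Qed.

End Subspace.

Section LieIdentities.
Variables (K : fieldType) (L : lieAlgType K).
Implicit Types a b c : L.

Lemma lieNr a b : [lie a, - b] = - [lie a, b].
Proof. by rewrite -scaleN1r lieZr scaleN1r. Qed.

Lemma lieBr a b c : [lie a, b - c] = [lie a, b] - [lie a, c].
Proof. by rewrite lieDr lieNr. Qed.

Lemma lie_leibnizr a b c :
  [lie a, [lie b, c]] = [lie [lie a, b], c] + [lie b, [lie a, c]].
Proof.
have /eqP := lie_jacobi a b c.
rewrite [X in _ + X]lieC (lieC c a) lieNr -addrA -opprD subr_eq0 => /eqP ->.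
by rewrite addrC.
Qed.

Lemma lie_leibnizl a b c :
  [lie [lie a, b], c] = [lie a, [lie b, c]] - [lie b, [lie a, c]].
Proof. by rewrite lie_leibnizr addrK. Qed.

End LieIdentities.

Definition is_ideal {K : fieldType} {L : lieAlgType K} (A : set L) : Prop :=
  is_subspace A /\ forall z a, A a -> A [lie z, a].

Lemma idealr (K : fieldType) (L : lieAlgType K) (A : set L) z a :
  is_ideal A -> A a -> A [lie a, z].
Proof.
case=> sA Az Aa; rewrite lieC -sub0r; apply: (subspaceB sA); last exact: Az.
by case: sA.
Qed.

Section Filtration.
Variable K : fieldType.
Local Notation L := (Ltilde K).
Local Notation x := (genx K).
Local Notation y := (geny K).
Implicit Types (a b f g h z w : L) (A : set L).

(** * The free Lie algebra is generated by x and y *)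

Lemma Ltilde_ind A : is_subspace A ->
  (forall a b, A a -> A b -> A [lie a, b]) -> A x -> A y -> forall a, A a.
Proof.
move=> sA Alie Ax Ay; apply: fl_ind.
elim=> [[]||a iha b ihb|k a iha|a iha b ihb] //.
- by case: sA.
- by rewrite fl_classD; apply: (@subspaceD K L).
- by case: sA => A0 /(_ k _ 0 iha A0); rewrite addr0 fl_classZ.
- by rewrite fl_classB; apply: Alie.
Qed.

Lemma linear_lier z : linear (fun a : L => [lie z, a]).
Proof. exact: lie_linearr. Qed.

Lemma linear_liel z : linear (fun a : L => [lie a, z]).
Proof. exact: lie_linearl. Qed.

Lemma is_ideal_Lbar : is_ideal (@Lbar K).
Proof.
by split=> [|z a _]; [apply: subspace_bracket_span | apply: bracket_span_mem].
Qed.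

(** Modulo an ideal that contains [[x, y]] the generators commute, so the
    quotient is abelian. *)
Lemma Lbar_sub_ideal A : is_ideal A -> A [lie x, y] -> @Lbar K `<=` A.
Proof.
move=> iA Axy; have [sA Az] := iA.
have gen_commute z : A [lie z, x] -> A [lie z, y] -> forall a, A [lie z, a].
  apply: Ltilde_ind; first exact: subspace_preim (linear_lier z) sA.
  move=> a b /= Aa Ab; rewrite lie_leibnizr.
  by apply: (subspaceD sA); [apply: idealr | apply: Az].
have A0 : A 0 by case: sA.
apply: bracket_span_sub => // a b _ _; move: a.
apply: Ltilde_ind; first exact: subspace_preim (linear_liel b) sA.
- move=> a c /= Aa Ac; rewrite lie_leibnizl.
  by apply: (subspaceB sA); apply: Az.
- by apply: gen_commute => //; rewrite liexx.
- apply: gen_commute; last by rewrite liexx.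
  by rewrite lieC -sub0r; apply: (subspaceB sA).
Qed.

(** * The filtration as a lower central series *)

Lemma subspace_Lfilt i : is_subspace (@Lfilt K i).
Proof. by case: i => [|i]; apply: subspace_bracket_span. Qed.

Lemma is_ideal_Lfilt i : is_ideal (@Lfilt K i).
Proof.
elim: i => [|i [_ IHi]]; first exact: is_ideal_Lbar.
split=> [|z]; first exact: subspace_Lfilt.
apply: bracket_span_sub => [|a b La Lb].
  exact: subspace_preim (linear_lier z) (subspace_Lfilt i.+1).
rewrite /= lie_leibnizr; apply: subspaceD; first exact: subspace_bracket_span.
  by apply: bracket_span_mem => //; apply: bracket_span_mem.
by apply: bracket_span_mem => //; apply: IHi.
Qed.

Lemma Lfilt_lie z i a : @Lfilt K i a -> @Lfilt K i [lie z, a].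
Proof. by case: (is_ideal_Lfilt i) => _; apply. Qed.

Lemma LfiltS i : @Lfilt K i.+1 `<=` @Lfilt K i.
Proof.
apply: bracket_span_sub => [|a b _]; [exact: subspace_Lfilt|exact: Lfilt_lie].
Qed.

Lemma Lfilt_Lbar i : @Lfilt K i `<=` @Lbar K.
Proof. by elim: i => // i IHi a /LfiltS /IHi. Qed.

Lemma lie_Lfilt i j a b :
  @Lfilt K i a -> @Lfilt K j b -> @Lfilt K (i + j).+1 [lie a, b].
Proof.
elim: i => [|i IHi] in j a b *; first exact: bracket_span_mem.
move=> La Lb; move: a La; apply: bracket_span_sub.
  exact: subspace_preim (linear_liel b) (subspace_Lfilt _).
move=> a c La Lc /=; rewrite lie_leibnizl.
apply: (subspaceB (subspace_Lfilt (i + j).+2)).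
  by apply: bracket_span_mem => //; apply: IHi.
by rewrite -addnS; apply: (IHi j.+1) => //; apply: bracket_span_mem.
Qed.

(** * The derivations D_f and the filtration *)

Lemma linear_Dder f : linear (Dder f).
Proof. by case: (Dder_derivation f). Qed.

Lemma Dder_lie f a b : Dder f [lie a, b] = [lie Dder f a, b] + [lie a, Dder f b].
Proof. by case: (Dder_derivation f). Qed.

Lemma Dder_xy f : Dder f [lie x, y] = [lie x, [lie y, f]].
Proof. by rewrite Dder_lie Dder_x Dder_y lie0l add0r. Qed.

Lemma Dder_linear_index a : linear (fun f => Dder f a).
Proof.
move=> k f g; apply/esym.
apply: (@Dder_unique _ _ (fun a => k *: Dder f a + Dder g a)) a.
- split=> [c a b|a b].
    by rewrite !linear_Dder !scalerDr !scalerA [k * c]mulrC addrACA.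
  by rewrite !Dder_lie lieDl lieDr lieZl lieZr scalerDr addrACA.
- by rewrite !Dder_x scaler0 addr0.
- by rewrite !Dder_y lieDr lieZr.
Qed.

Lemma Dder_range f i a : @Lfilt K i f -> @Lfilt K i (Dder f a).
Proof.
move=> Lf; have iL := is_ideal_Lfilt i; have sL := subspace_Lfilt i; move: a.
apply: Ltilde_ind; first exact: subspace_preim (linear_Dder f) sL.
- move=> a b /= La Lb; rewrite Dder_lie.
  by apply: subspaceD; [|apply: idealr|apply: Lfilt_lie].
- by rewrite /= Dder_x; case: sL.
- by rewrite /= Dder_y; apply: Lfilt_lie.
Qed.

(** Induction on [j]: for [a] in [L^0] and [b] in [L^j], the bracket [[D_f a, b]]
    of an element of [L^i] with one of [L^j] is in [L^(i+j+1)], and so is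
    [[a, D_f b]], because [D_f b] is in [L^(i+j)]. *)
Lemma Dder_Lfilt f i j a :
  @Lfilt K i f -> @Lfilt K j a -> @Lfilt K (i + j) (Dder f a).
Proof.
move=> Lf; elim: j => [|j IHj] in a *.
  by rewrite addn0 => _; apply: Dder_range.
move: a; apply: bracket_span_sub.
  exact: subspace_preim (linear_Dder f) (subspace_Lfilt _).
move=> a b La Lb /=; rewrite Dder_lie addnS.
apply: (subspaceD (subspace_Lfilt (i + j).+1)).
  by apply: lie_Lfilt => //; apply: Dder_range.
by apply: bracket_span_mem => //; apply: IHj.
Qed.

(** * The quotient of the first two steps as a cyclic module *)

Definition eq_mod1 a b : Prop := @Lfilt K 1 (a - b).

Lemma eq_mod1_trans b a c : eq_mod1 a b -> eq_mod1 b c -> eq_mod1 a c.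
Proof.
by move=> ab /(subspaceD (subspace_Lfilt 1) ab); rewrite addrA subrK.
Qed.

Lemma eq_mod1_lie z a b : eq_mod1 a b -> eq_mod1 [lie z, a] [lie z, b].
Proof. by rewrite /eq_mod1 -lieBr; apply: Lfilt_lie. Qed.

Lemma eq_mod1B a a' b b' :
  eq_mod1 a a' -> eq_mod1 b b' -> eq_mod1 (a - b) (a' - b').
Proof.
move=> aa' /(subspaceB (subspace_Lfilt 1) aa').
by rewrite /eq_mod1 !opprD !opprK addrACA.
Qed.

(** The commutator of [ad z] and [ad w] is [ad [z, w]], with [[z, w]] in [L^0]. *)
Lemma ad_commute_mod1 z w a : @Lbar K a ->
  eq_mod1 [lie z, [lie w, a]] [lie w, [lie z, a]].
Proof.
move=> La; rewrite /eq_mod1 -lie_leibnizl.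
by apply: bracket_span_mem => //; apply: bracket_span_mem.
Qed.

(** A linear map [E] with this property that also maps [L^0] to itself maps
    [L^1 = [L^0, L^0]] to itself, so it induces an endomorphism of the module
    [L^0 / L^1]. *)
Definition ad_commuting (E : L -> L) : Prop :=
  forall z a, @Lbar K a -> eq_mod1 (E [lie z, a]) [lie z, E a].

(** As an ideal [L^0] is generated by [[x, y]], so a module map on [L^0 / L^1]
    that kills the class of [[x, y]] is zero. *)
Lemma ad_commuting_Lfilt1 (E : L -> L) : linear E -> ad_commuting E ->
  @Lfilt K 1 (E [lie x, y]) -> forall a, @Lbar K a -> @Lfilt K 1 (E a).
Proof.
move=> lE cE Exy a La.
suff [] : (@Lbar K `&` [set a | @Lfilt K 1 (E a)]) a by [].
move: a La; apply: Lbar_sub_ideal; last by split=> //; apply: bracket_span_mem.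
split.
  apply: subspaceI; first exact: subspace_bracket_span.
  exact: subspace_preim lE (subspace_Lfilt 1).
move=> z a [La Ea]; split; first exact: bracket_span_mem.
have := subspaceD (subspace_Lfilt 1) (cE z a La) (Lfilt_lie z Ea).
by rewrite subrK.
Qed.

Lemma ad_commutingB (E F : L -> L) :
  ad_commuting E -> ad_commuting F -> ad_commuting (fun a => E a - F a).
Proof. by move=> cE cF z a La; rewrite lieBr; apply: eq_mod1B; auto. Qed.

(** If [E] maps [L^0] to itself, then so does [ad z \o E], and [ad z] commutes
    with every [ad w] modulo [L^1]. *)
Lemma ad_commuting_lie z (E : L -> L) : (forall a, @Lbar K a -> @Lbar K (E a)) ->
  ad_commuting E -> ad_commuting (fun a => [lie z, E a]).
Proof.
move=> LE cE w a La; apply: (eq_mod1_trans (eq_mod1_lie z (cE w a La))).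
by apply: ad_commute_mod1; apply: LE.
Qed.

Lemma ad_commuting_id : ad_commuting id.
Proof.
by move=> z a _; rewrite /eq_mod1 /= subrr; case: (subspace_Lfilt 1).
Qed.

Lemma ad_commuting_Dder f : @Lbar K f -> ad_commuting (Dder f).
Proof.
move=> Lf z a La; rewrite /eq_mod1 Dder_lie addrK.
by apply: bracket_span_mem => //; apply: (Dder_range (i := 0)).
Qed.

Lemma ad_commuting_xy : ad_commuting (fun a => [lie x, [lie y, a]]).
Proof.
apply: (@ad_commuting_lie x (fun a => [lie y, a])).
  by move=> a _; apply: bracket_span_mem.
by apply: (@ad_commuting_lie y id) => //; apply: ad_commuting_id.
Qed.

(** In module terms: [D_[x, y]] is multiplication by [XY]. *)
Lemma Dder_xy_mod1 g : @Lbar K g ->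
  eq_mod1 (Dder [lie x, y] g) [lie x, [lie y, g]].
Proof.
have Lxy : @Lbar K [lie x, y] by apply: bracket_span_mem.
move: g; apply: ad_commuting_Lfilt1.
- apply: linearB_fun; first exact: linear_Dder.
  by move=> k a b; rewrite !linear_lier.
- exact: ad_commutingB (ad_commuting_Dder Lxy) ad_commuting_xy.
- by rewrite Dder_xy subrr; case: (subspace_Lfilt 1).
Qed.

(** In module terms: [f |-> D_f g] is also a module map. Both sides are module
    maps in [g], and at [g = [x, y]] they are [XY z f] and [z XY f]. *)
Lemma ad_commuting_Dder_index g : @Lbar K g -> ad_commuting (fun f => Dder f g).
Proof.
move=> Lg z f Lf; move: g Lg.
apply: (ad_commuting_Lfilt1 (E := fun g => Dder [lie z, f] g - [lie z, Dder f g])).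
- apply: linearB_fun; first exact: linear_Dder.
  by move=> k a b; rewrite linear_Dder linear_lier.
- apply: ad_commutingB; first by apply: ad_commuting_Dder; apply: bracket_span_mem.
  apply: ad_commuting_lie; last exact: ad_commuting_Dder.
  by move=> a _; apply: (Dder_range (i := 0)).
- by rewrite !Dder_xy; apply: ad_commuting_xy.
Qed.

Lemma Dder_sym_mod1 f g : @Lbar K f -> @Lbar K g ->
  eq_mod1 (Dder f g) (Dder g f).
Proof.
move=> Lf Lg; move: f Lf.
apply: (ad_commuting_Lfilt1 (E := fun f => Dder f g - Dder g f)).
- by apply: linearB_fun; [apply: Dder_linear_index | apply: linear_Dder].
- apply: ad_commutingB; first exact: ad_commuting_Dder_index.
  exact: ad_commuting_Dder.
- by rewrite Dder_xy; apply: Dder_xy_mod1.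
Qed.

(** * The bracket of Ihara and the filtration *)

Lemma ihara_Lfilt i j f g : @Lfilt K i f -> @Lfilt K j g ->
  @Lfilt K (i + j) (ihara f g).
Proof.
move=> Lf Lg; have sL := subspace_Lfilt (i + j).
apply: (subspaceB sL); last by rewrite addnC; apply: Dder_Lfilt.
by apply: (subspaceD sL); [apply/LfiltS/lie_Lfilt|apply: Dder_Lfilt].
Qed.

Lemma ihara_Lbar f g : @Lbar K f -> @Lbar K g -> @Lfilt K 1 (ihara f g).
Proof.
move=> Lf Lg; rewrite /ihara -addrA.
apply: (subspaceD (subspace_Lfilt 1)); last exact: Dder_sym_mod1.
exact: bracket_span_mem.
Qed.

End Filtration.

Theorem proposition2p1 (R : realType) :
  (forall i j : nat,
     bracket_span (@ihara R[i]) (@Lfilt R[i] i) (@Lfilt R[i] j)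
       `<=` @Lfilt R[i] (i + j)%N) /\
  bracket_span (@ihara R[i]) (@Lfilt R[i] 0%N) (@Lfilt R[i] 0%N)
    `<=` @Lfilt R[i] 1%N.
Proof.
split=> [i j|]; apply: bracket_span_sub; try exact: subspace_Lfilt.
  by move=> f g; apply: ihara_Lfilt.
by move=> f g; apply: ihara_Lbar.
Qed.
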